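(* Let $$A = \{ (x,y) \in \mathbf{Bad}^2 : \exists\, c(x,y) > 0 \text{ such that for all } n \geq 1:\ q_n(x)\,\|q_n(x)x\|\,\|q_n(x)y\| \geq c(x,y) \text{ and } q_n(y)\,\|q_n(y)x\|\,\|q_n(y)y\| \geq c(x,y)\} \subset \mathbb{R}^2.$$ Let $x \in \mathbf{Bad}$, and let $A(x) = A \cap L_x$, where $L_x = \{x\} \times \mathbb{R}$ is the vertical line in $\mathbb{R}^2$ passing through $x$. Then $$\dim_H A(x) \geq \frac{1}{2}.$$
   Context: For real $t$, $\|t\|$ denotes the distance from $t$ to the nearest integer. $\mathbf{Bad}$ is the set of badly approximable numbers: $\mathbf{Bad} = \{ \alpha \in \mathbb{R} : \exists\, c(\alpha) > 0 \text{ such that } \|q\alpha\| > c(\alpha) q^{-1} \text{ for all integers } q \geq 1 \}$ (all such numbers are irrational). For an irrational real $\alpha$ with regular continued fraction expansion $\alpha = [a_0; a_1, a_2, \ldots]$ ($a_0 \in \mathbb{Z}$, $a_i$ positive integers for $i\ge 1$), $p_n(\alpha)/q_n(\alpha) = [a_0; a_1, \ldots, a_n]$ denotes its $n$-th convergent in lowest terms with $q_n(\alpha) \geq 1$, so $q_n(\alpha)$ is the denominator of the $n$-th convergent. $\dim_H$ denotes Hausdorff dimension. *)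

(* Defs.v *)
From HB Require Import structures.
From mathcomp Require Import all_boot all_order all_algebra.
From mathcomp Require Import all_classical all_reals all_analysis.

Set Implicit Arguments.
Unset Strict Implicit.
Unset Printing Implicit Defensive.

Import Order.TTheory GRing.Theory Num.Theory.
Local Open Scope classical_set_scope.
Local Open Scope ring_scope.

Definition dist_int (R : realType) (t : R) : R :=
  inf [set `|t - m%:~R| | m in [set: int]].

Definition Bad (R : realType) : set R :=
  [set a | exists2 c : R, 0 < c &
    forall q : nat, (1 <= q)%N -> c * q%:R^-1 < dist_int (q%:R * a)].

(* If x is irrational, no iterate below is an integer. For rational x the
   iteration reaches 0^-1 = 0 and the remaining digits are meaningless; this
   case does not arise for elements of Bad. *)
Definition complete_quotient (R : realType) (x : R) (n : nat) : R :=
  iter n (fun t : R => (t - (Num.floor t)%:~R)^-1) x.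

Definition partial_quotient (R : realType) (x : R) (n : nat) : int :=
  Num.floor (complete_quotient x n).

(* [a 0; a 1, ..., a n] *)
Fixpoint finite_cf (a : nat -> int) (n : nat) : rat :=
  if n is m.+1 then (a 0)%:~R + (finite_cf (fun k => a k.+1) m)^-1
  else (a 0)%:~R.

Definition convergent (R : realType) (x : R) (n : nat) : rat :=
  finite_cf (partial_quotient x) n.

(* denq is the positive denominator of the reduced fraction *)
Definition q_ (R : realType) (n : nat) (x : R) : int := denq (convergent x n).

(* Product types carry the max norm in the library, hence the explicit
   Euclidean distance. *)
Definition eucl_dist (R : realType) (p q : R * R) : R :=
  Num.sqrt ((p.1 - q.1) ^+ 2 + (p.2 - q.2) ^+ 2).

Section Hausdorff.
Context (R : realType) (T : choiceType) (d : T -> T -> R).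

(* The diameter of set0 is -oo here, so set0 satisfies every bound
   diam U <= delta. *)
Definition diam (U : set T) : \bar R :=
  ereal_sup [set (d u.1 u.2)%:E | u in U `*` U].

(* Countable delta-covers; finite ones are padded with set0, which contributes
   nothing to the sum, also for s = 0 (whereas 0 `^ 0 = 1 for singletons). *)
Definition hausdorff_premeasure (s delta : R) (E : set T) : \bar R :=
  ereal_inf [set (\sum_(0 <= i <oo | U i != set0) diam (U i) `^ s)%E |
    U in [set U : nat -> set T |
      E `<=` \bigcup_i U i /\ forall i, (diam (U i) <= delta%:E)%E]].

Definition hausdorff_measure (s : R) (E : set T) : \bar R :=
  ereal_sup [set hausdorff_premeasure s delta E | delta in [set delta : R | 0 < delta]].

Definition hausdorff_dim (E : set T) : \bar R :=
  ereal_inf [set s%:E | s in [set s : R | 0 <= s /\ hausdorff_measure s E = 0%E]].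

End Hausdorff.

Definition set_A (R : realType) : set (R * R) :=
  [set p | [/\ Bad p.1, Bad p.2 & exists2 c : R, 0 < c &
    forall n : nat, (1 <= n)%N ->
      let qx : R := (q_ n p.1)%:~R in
      let qy : R := (q_ n p.2)%:~R in
      c <= qx * dist_int (qx * p.1) * dist_int (qx * p.2) /\
      c <= qy * dist_int (qy * p.1) * dist_int (qy * p.2)]].

Definition vertical_line (R : realType) (x : R) : set (R * R) :=
  [set x] `*` [set: R].

(* Main.v *)
Require Import Defs.
From mathcomp Require Import all_boot all_order all_algebra.
From mathcomp Require Import all_classical all_reals all_analysis.
From mathcomp Require Import ring lra zify.

(** Since [x] is badly approximable, [q_n(x) ||q_n(x) x||] is bounded below, and
    likewise for [y] once [y] has bounded digits. So it suffices to find many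
    [y = [0; a_1, a_2, ...]] with digits in a fixed range such that
    [||q_n(y) x|| >= e] and [||q_k(x) y|| >= e] for all [n] and [k]. Both
    conditions are met while the digits are chosen one after the other.

    As [q_(n+1) = a q_n + q_(n-1)], the numbers [q_(n+1) x] for consecutive
    values of [a] form an arithmetic progression of step [q_n x]. If the step is
    at least [e] away from the integers, three consecutive terms cannot all be
    within [e] of integers (dist_int_progression), so a third of all digits
    preserves the first condition.

    The condition on [q_k(x)] is dealt with at the step where
    [q_(n-1)^2 <= q_k(x) < q_n^2]. All [y] that start with [a_1, ..., a_n] and
    have digits at least 2 then have [q_k(x) y] in a window of length one half,
    which is within [e] of at most one integer, while different values of
    [a_(n+1)] separate the [y] by a fixed multiple of [1 / q_k(x)]. For small
    [e] at most one digit is lost (hits_unique). The denominators of [x] at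
    least double every two steps, so the number of [k] to deal with at one step
    is logarithmic in the size of the digits (lacunary_window).

    Hence, with digits below [B = 2^(i+3)], at least [N = 2^i] of them are
    admissible at every step (count_admissible), whereas two sequences that
    differ among the first [n] digits give values at least [B^(-2n) / 2] apart
    (cf_value_separated). The resulting Cantor set has dimension at least
    [log N / (2 log B)], which tends to 1/2 as [i] grows.

    The dimension bound needs no measure on the Cantor set. A covering set of
    diameter comparable to [B^(-2n)] meets the Cantor set inside one cylinder of
    level [n], that is, in the numbers whose first [n] digits form a given word,
    and is charged [N^(-n)], which is at most a constant times the diameter to
    the power [s]. If the charges add up to less than one, a greedy descent in
    the tree of admissible digits produces a branch through none of the
    cylinders (branch_avoiding_words), that is, a point outside the cover. *)

Set Implicit Arguments.
Unset Strict Implicit.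
Unset Printing Implicit Defensive.

Import Order.TTheory GRing.Theory Num.Theory.
Local Open Scope classical_set_scope.
Local Open Scope ring_scope.

(** * Distance to the nearest integer *)

Lemma dist_int_le (R : realType) (t : R) (m : int) :
  dist_int t <= `|t - m%:~R|.
Proof.
apply: ge_inf; last by exists m.
by exists 0 => _ [k _ <-].
Qed.

Lemma le_dist_int (R : realType) (e t : R) :
  (forall m : int, e <= `|t - m%:~R|) -> e <= dist_int t.
Proof.
move=> h; apply: lb_le_inf; first by exists `|t - 0%:~R|, 0.
by move=> _ [m _ <-].
Qed.

Lemma dist_int_lt (R : realType) (e t : R) :
  dist_int t < e -> exists m : int, `|t - m%:~R| < e.
Proof.
move=> h; apply: contrapT => /forallNP h'.
move: h; apply/negP; rewrite -leNgt; apply: le_dist_int => m.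
by rewrite leNgt; apply/negP; exact: h'.
Qed.

Lemma int_eq_dist_lt1 (R : realType) (m n : int) :
  `|m%:~R - n%:~R| < 1 :> R -> m = n.
Proof.
by rewrite -rmorphB -intr_norm (ltr_int _ _ 1) => h; lia.
Qed.

(** If [b], [b + th] and [b + 2 th] all lie within [e] of integers, their
    vanishing second difference forces the three nearest integers into
    arithmetic progression, so the three errors are in arithmetic progression
    too and their common difference, half of the difference of the extreme
    ones, is less than [e]; hence [th] is within [e] of an integer. *)
Lemma dist_int_progression (R : realType) (e th b : R) :
  4 * e <= 1 -> e <= dist_int th ->
  [\/ e <= dist_int b, e <= dist_int (b + th) | e <= dist_int (b + 2 * th)].
Proof.
move=> e4 eth.
have [|/dist_int_lt[m0 h0]] := leP e (dist_int b); first by constructor 1.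
have [|/dist_int_lt[m1 h1]] := leP e (dist_int (b + th)); first by constructor 2.
have [|/dist_int_lt[m2 h2]] := leP e (dist_int (b + 2 * th));
  first by constructor 3.
have m02 : m0 + m2 = 2 * m1.
  apply: (@int_eq_dist_lt1 R); rewrite rmorphD rmorphM /=.
  move: h0 h1 h2; rewrite !ltr_norml => /andP[? ?] /andP[? ?] /andP[? ?].
  by apply/andP; split; lra.
have m02R : m0%:~R + m2%:~R = 2 * m1%:~R :> R.
  by rewrite -rmorphD /= m02 rmorphM.
have := le_trans eth (dist_int_le th (m1 - m0)).
rewrite rmorphB /= leNgt => /negP[].
move: h0 h1 h2; rewrite !ltr_norml => /andP[? ?] /andP[? ?] /andP[? ?].
by apply/andP; split; lra.
Qed.

(** * Continuants *)

(** A list of digits is read from the last digit to the first, so that adding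
    a digit to an expansion is consing. On the digits [a_n :: ... :: a_1] the
    seed [(1, 0)] produces the pair [(q_n, q_(n-1))] of [0; a_1, ..., a_n], and
    the seed [(0, 1)] the pair [(p_n, p_(n-1))]. *)
Definition continuant (u : nat * nat) (h : seq nat) : nat * nat :=
  foldr (fun a v => (a * v.1 + v.2, v.1)%N) u h.

Definition den h := (continuant (1, 0)%N h).1.
Definition den' h := (continuant (1, 0)%N h).2.
Definition num h := (continuant (0, 1)%N h).1.
Definition num' h := (continuant (0, 1)%N h).2.

(** The value [0; a_1, ..., a_(n-1), a_n + t]: the variable [t] stands for the
    inverse of the next complete quotient, so [t = 0] is the convergent. *)
Definition cf_tail (F : numFieldType) (h : seq nat) (t : F) : F :=
  foldl (fun t a => (a%:R + t)^-1) t h.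

Definition history (a : nat -> nat) (n : nat) : seq nat := rev (mkseq a n).

Lemma historyS a n : history a n.+1 = a n :: history a n.
Proof. by rewrite /history mkseqS rev_rcons. Qed.

Lemma historySl a n :
  history a n.+1 = rcons (history (fun k => a k.+1) n) (a 0%N).
Proof.
rewrite /history /mkseq /= rev_cons; congr (rcons (rev _) _).
by rewrite -[1%N]/(1 + 0)%N iotaDl -map_comp; exact: eq_map.
Qed.

Lemma history_all (P : pred nat) a n :
  (forall k, P (a k)) -> all P (history a n).
Proof. by move=> Pa; elim: n => // n IH; rewrite historyS /= Pa IH. Qed.

Lemma size_history a n : size (history a n) = n.
Proof. by rewrite size_rev size_mkseq. Qed.

Lemma den_gt0 h : all (leq 1) h -> (0 < den h)%N.
Proof.
elim: h => [//|a h IH] /= /andP[a0 /IH h0].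
by rewrite /den /= addn_gt0 muln_gt0 a0 h0.
Qed.

Lemma den'_le h : all (leq 1) h -> (den' h <= den h)%N.
Proof.
case: h => [//|a h] /= /andP[a0 h0].
rewrite /den' /den /= -[X in (X <= _)%N]/(den h) -/(den h).
by apply: leq_trans (leq_addr _ _); rewrite leq_pmull.
Qed.

Lemma denS a h : den (a :: h) = (a * den h + den' h)%N.
Proof. by []. Qed.

Lemma den'S a h : den' (a :: h) = den h.
Proof. by []. Qed.

Lemma cf_tailE (F : numFieldType) h (t : F) : all (leq 1) h -> 0 <= t ->
  cf_tail h t = ((num h)%:R + (num' h)%:R * t) / ((den h)%:R + (den' h)%:R * t).
Proof.
elim: h t => [|a h IH] t /=.
  by move=> _ _; rewrite /num /num' /den /den' /= mul0r mul1r addr0 divr1 add0r.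
move=> /andP[a0 h0] t0.
have at0 : 0 < a%:R + t by rewrite ltr_wpDr // ltr0n.
rewrite IH ?invr_ge0 1?ltW // /num /num' /den /den' /= -/(num h) -/(num' h).
rewrite -/(den h) -/(den' h) !natrD !natrM.
have dh : 0 < (den h)%:R :> F by rewrite ltr0n den_gt0.
have d1 : (a%:R * (den h)%:R + (den' h)%:R + (den h)%:R * t) != 0.
  rewrite gt_eqF // ltr_wpDr ?mulr_ge0 // ltr_wpDr //.
  by rewrite mulr_gt0 // ltr0n.
by field; apply/andP; split; [exact: d1 | rewrite gt_eqF].
Qed.

Lemma continuant_det (F : comNzRingType) h :
  (num h)%:R * (den' h)%:R - (num' h)%:R * (den h)%:R
    = (-1) ^+ (size h).+1 :> F.
Proof.
elim: h => [|a h IH]; first by rewrite /num /num' /den /den' /=; ring.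
rewrite exprS -IH /num /num' /den /den' /= -/(num h) -/(num' h).
rewrite -/(den h) -/(den' h) !natrD !natrM; ring.
Qed.

Lemma cf_tail_dist (F : numFieldType) h (t u : F) :
  all (leq 1) h -> 0 <= t -> 0 <= u ->
  `|cf_tail h t - cf_tail h u| = `|t - u| /
    (((den h)%:R + (den' h)%:R * t) * ((den h)%:R + (den' h)%:R * u)).
Proof.
move=> h0 t0 u0; rewrite !cf_tailE //.
have dh : 0 < (den h)%:R :> F by rewrite ltr0n den_gt0.
have dt : 0 < (den h)%:R + (den' h)%:R * t by rewrite ltr_wpDr ?mulr_ge0.
have du : 0 < (den h)%:R + (den' h)%:R * u by rewrite ltr_wpDr ?mulr_ge0.
have -> : ((num h)%:R + (num' h)%:R * t) / ((den h)%:R + (den' h)%:R * t) -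
  ((num h)%:R + (num' h)%:R * u) / ((den h)%:R + (den' h)%:R * u) =
  - ((num h)%:R * (den' h)%:R - (num' h)%:R * (den h)%:R) * (t - u) /
   (((den h)%:R + (den' h)%:R * t) * ((den h)%:R + (den' h)%:R * u)).
  by field; rewrite !gt_eqF.
rewrite continuant_det normrM normfV (gtr0_norm (mulr_gt0 dt du)).
by rewrite normrM normrN normrX normrN1 expr1n mul1r.
Qed.

Lemma cf_tailS_left (F : numFieldType) a n (t : F) :
  cf_tail (history a n.+1) t =
  ((a 0%N)%:R + cf_tail (history (fun k => a k.+1) n) t)^-1.
Proof. by rewrite historySl /cf_tail -cats1 foldl_cat. Qed.

(** Only the integer part may be nonpositive, and it does not influence the
    denominator. *)
Lemma finite_cfE (a : nat -> int) (d : nat -> nat) n :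
  (forall k, a k.+1 = (d k)%:Z) ->
  finite_cf a n = (a 0%N)%:~R + cf_tail (history d n) 0.
Proof.
elim: n a d => [|n IH] a d ad; first by rewrite /= addr0.
rewrite cf_tailS_left /= (IH _ (fun k => d k.+1)); last by move=> k; rewrite ad.
by rewrite ad.
Qed.

Lemma denq_finite_cf (a : nat -> int) (d : nat -> nat) n :
  (forall k, a k.+1 = (d k)%:Z) -> (forall k, (0 < d k)%N) ->
  denq (finite_cf a n) = (den (history d n))%:Z.
Proof.
move=> ad d0; rewrite (finite_cfE _ ad); set h := history d n.
have h0 : all (leq 1) h by exact: history_all.
have dh : (0 < den h)%N by exact: den_gt0.
rewrite cf_tailE // !mulr0 !addr0.
have -> : (a 0%N)%:~R + (num h)%:R / (den h)%:R =
   (a 0%N * (den h)%:Z + (num h)%:Z)%:~R / ((den h)%:Z)%:~R :> rat.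
  rewrite rmorphD rmorphM /= -!pmulrn.
  by field; rewrite pnatr_eq0 -lt0n.
rewrite coprimeq_den; first by rewrite eqz_nat gtn_eqF // absz_nat.
rewrite -[coprime _ _]/(coprimez _ _).
(* The determinant of two consecutive convergents is a Bezout relation. *)
have := continuant_det int h; move: (size h).+1 => k hk.
apply/coprimezP; exists ((-1) ^+ k * (den' h)%:Z,
   - (-1) ^+ k * ((num' h)%:Z + a 0%N * (den' h)%:Z)) => /=.
have e : (-1) ^+ k * (-1) ^+ k = 1 :> int by rewrite -exprD addnn -mul2n exprM expr1n.
rewrite -[RHS]e -{3}hk !natz; ring.
Qed.

(** * Convergent denominators of an irrational number *)

Lemma Bad_irrational (R : realType) (x : R) : Bad x -> forall r : rat, x != ratr r.
Proof.
move=> [c c0 h] r; apply/eqP => xr.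
have dr : (0 < `|denq r|)%N by rewrite absz_gt0 denq_neq0.
have := h _ dr; rewrite ltNge => /negP[].
have := dist_int_le (`|denq r|%:R * x) (numq r).
rewrite xr natr_absz (gtr0_norm (denq_gt0 r)) /ratr mulrCA divff ?mulr1; last first.
  by rewrite intr_eq0 denq_neq0.
rewrite subrr normr0 => hle; apply: (le_trans hle).
by rewrite mulr_ge0 ?invr_ge0 ?ler0z ?ltW // denq_gt0.
Qed.

Lemma complete_quotient_irrational (R : realType) (x : R) :
  (forall r : rat, x != ratr r) ->
  forall n (r : rat), complete_quotient x n != ratr r.
Proof.
move=> xr; elim=> [//|n IH] r; apply/eqP => /= h.
have /eqP[] := IH (r^-1 + (Num.floor (complete_quotient x n))%:~R).
have -> : ratr (r^-1 + (Num.floor (complete_quotient x n))%:~R) =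
  (ratr r)^-1 + (Num.floor (complete_quotient x n))%:~R :> R.
  by rewrite rmorphD fmorphV /= ratr_int.
by rewrite -h invrK subrK.
Qed.

Lemma partial_quotient_ge1 (R : realType) (x : R) n :
  (forall r : rat, x != ratr r) -> 1 <= partial_quotient x n.+1.
Proof.
move=> xr; have := complete_quotient_irrational xr n.
rewrite /partial_quotient [complete_quotient x n.+1]iterS.
rewrite -/(complete_quotient x n); set t := complete_quotient x n => tr.
have /andP[h1 h2] := floor_itv t; have {tr} := tr (Num.floor t)%:~R.
rewrite ratr_int => tr.
rewrite floor_ge_int.
have t0 : 0 < t - (Num.floor t)%:~R by rewrite subr_gt0 lt_neqAle eq_sym tr.
rewrite invf_ge1 // lerBlDl; apply: ltW; move: h2; by rewrite rmorphD.
Qed.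

Definition digit (R : realType) (x : R) (k : nat) : nat :=
  `|partial_quotient x k.+1|%N.

Lemma digitE (R : realType) (x : R) k : (forall r : rat, x != ratr r) ->
  partial_quotient x k.+1 = (digit x k)%:Z.
Proof.
move=> xr; rewrite gez0_abs //.
by apply: le_trans (partial_quotient_ge1 k xr).
Qed.

Lemma digit_gt0 (R : realType) (x : R) k : (forall r : rat, x != ratr r) ->
  (0 < digit x k)%N.
Proof.
move=> xr; rewrite -ltz_nat -digitE //.
by apply: lt_le_trans (partial_quotient_ge1 k xr).
Qed.

Lemma q_E (R : realType) (x : R) n : (forall r : rat, x != ratr r) ->
  q_ n x = (den (history (digit x) n))%:Z.
Proof.
move=> xr; apply: denq_finite_cf => k; [exact: digitE | exact: digit_gt0].
Qed.

Section Growth.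
Variables (d : nat -> nat).
Hypothesis d0 : forall k, (0 < d k)%N.

Lemma den_history_gt0 n : (0 < den (history d n))%N.
Proof. by apply: den_gt0; exact: history_all. Qed.

Lemma den_history_le n : (den (history d n) <= den (history d n.+1))%N.
Proof.
by rewrite historyS denS (leq_trans _ (leq_addr _ _)) // leq_pmull.
Qed.

Lemma den_history_double n : (2 * den (history d n) <= den (history d n.+2))%N.
Proof.
rewrite [in leqRHS]historyS denS historyS den'S -historyS mul2n -addnn leq_add2r.
by rewrite (leq_trans (den_history_le n)) // leq_pmull.
Qed.

End Growth.

Lemma lt_den_history (a : nat -> nat) n :
  (forall k, 2 <= a k)%N -> (n < den (history a n))%N.
Proof.
move=> a2; elim: n => // n IH; rewrite historyS denS.
by have := leq_mul (a2 n) (leqnn (den (history a n))); lia.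
Qed.

(** * The number with prescribed digits *)

Lemma le0_of_le_geometric (R : realType) (u : R) :
  (forall k, u <= 2 * 4^-1 ^+ k) -> u <= 0.
Proof.
move=> h; rewrite leNgt; apply/negP => u0.
have [k hk] : exists k : nat, 2 / u < k%:R.
  exists (Num.bound (2 / u)); apply: archi_boundP; by rewrite divr_ge0 // ltW.
have h4 : k%:R < 4 ^+ k :> R by rewrite -natrX ltr_nat ltn_expl.
have := h k; rewrite leNgt => /negP[].
rewrite exprVn ltr_pdivrMr ?exprn_gt0 // mulrC -ltr_pdivrMr //.
exact: lt_trans h4.
Qed.

Definition shift (n : nat) (a : nat -> nat) (k : nat) : nat := a (n + k)%N.

Lemma shiftS n a : shift n.+1 a = shift 1 (shift n a).
Proof. by apply/funext => k; rewrite /shift addnA addn1. Qed.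

Lemma shift0n a n : shift n a 0 = a n.
Proof. by rewrite /shift addn0. Qed.

Section Value.
Variable R : realType.

Definition cf_approx (a : nat -> nat) (k : nat) : R := cf_tail (history a k) 0.

(** The approximations form a Cauchy sequence with error [4^-k], so that their
    limit is the supremum of the lower bounds [cf_approx a k - 4^-k]. *)
Definition cf_value (a : nat -> nat) : R :=
  sup (range (fun k => cf_approx a k - 4^-1 ^+ k)).

Implicit Type a : nat -> nat.

Lemma cf_approxS a k : cf_approx a k.+1 = ((a 0)%:R + cf_approx (shift 1 a) k)^-1.
Proof. exact: cf_tailS_left. Qed.

Lemma inv_tail_bounds (m : nat) (u : R) : (2 <= m)%N -> 0 <= u ->
  0 <= (m%:R + u)^-1 <= 2^-1.
Proof.
move=> m2 u0; have m2R : 2 <= m%:R :> R by rewrite ler_nat.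
have mu : 2 <= m%:R + u by lra.
by rewrite invr_ge0 (le_trans _ mu) //= lef_pV2 // posrE; lra.
Qed.

Lemma inv_tail_dist (m : nat) (u v : R) : (2 <= m)%N -> 0 <= u -> 0 <= v ->
  `|(m%:R + u)^-1 - (m%:R + v)^-1| <= `|u - v| / 4.
Proof.
move=> m2 u0 v0; have m2R : 2 <= m%:R :> R by rewrite ler_nat.
have mu : 0 < m%:R + u by lra.
have mv : 0 < m%:R + v by lra.
have -> : (m%:R + u)^-1 - (m%:R + v)^-1 = (v - u) / ((m%:R + u) * (m%:R + v)).
  by field; rewrite !gt_eqF.
rewrite normrM normfV (gtr0_norm (mulr_gt0 mu mv)) distrC ler_wpM2l //.
by rewrite lef_pV2 ?posrE ?mulr_gt0 //; nra.
Qed.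

Lemma cf_approx_bounds a k : (forall n, 2 <= a n)%N ->
  0 <= cf_approx a k <= 2^-1.
Proof.
elim: k a => [|k IH] a a2; first by rewrite /cf_approx /= lexx; lra.
have /andP[? _] := IH (shift 1 a) (fun n => a2 _).
by rewrite cf_approxS inv_tail_bounds.
Qed.

Lemma cf_approx_cauchy a k l : (forall n, 2 <= a n)%N -> (k <= l)%N ->
  `|cf_approx a k - cf_approx a l| <= 4^-1 ^+ k.
Proof.
elim: k l a => [|k IH] l a a2 kl.
  have /andP[? ?] := cf_approx_bounds l a2.
  by rewrite {1}/cf_approx /= sub0r normrN ger0_norm // expr0; lra.
case: l kl => // l kl; rewrite !cf_approxS.
have /andP[? _] := cf_approx_bounds k (fun n => a2 (1 + n)%N).
have /andP[? _] := cf_approx_bounds l (fun n => a2 (1 + n)%N).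
apply: le_trans (inv_tail_dist _ _ _) _ => //.
by rewrite exprSr ler_wpM2r // IH // => n; exact: a2.
Qed.

Lemma cf_value_near a k : (forall n, 2 <= a n)%N ->
  `|cf_approx a k - cf_value a| <= 4^-1 ^+ k.
Proof.
move=> a2.
have ub l : ubound (range (fun k => cf_approx a k - 4^-1 ^+ k))
    (cf_approx a l + 4^-1 ^+ l).
  move=> _ [m _ <-].
  have p (i : nat) : 0 <= 4^-1 ^+ i :> R by rewrite exprn_ge0.
  have pl := p l; have pm := p m.
  have [ml|/ltnW ml] := leqP m l; have := cf_approx_cauchy a2 ml;
    by rewrite ler_norml => /andP[? ?]; lra.
rewrite ler_norml lerBrDr lerBlDr; apply/andP; split.
- rewrite addrC lerBlDr; apply: ge_sup; last exact: ub.
  by exists (cf_approx a 0 - 4^-1 ^+ 0), 0%N.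
- rewrite addrC -lerBlDr; apply: ub_le_sup; last by exists k.
  by exists (cf_approx a 0 + 4^-1 ^+ 0); exact: ub.
Qed.

Lemma cf_value_ge0 a : (forall n, 2 <= a n)%N -> 0 <= cf_value a.
Proof.
move=> a2; rewrite -oppr_le0; apply: le0_of_le_geometric => k.
have := cf_value_near k a2; have /andP[? _] := cf_approx_bounds k a2.
have : 0 <= 4^-1 ^+ k :> R by rewrite exprn_ge0.
by rewrite ler_norml => ? /andP[? ?]; lra.
Qed.

Lemma cf_valueE a : (forall n, 2 <= a n)%N ->
  cf_value a = ((a 0)%:R + cf_value (shift 1 a))^-1.
Proof.
move=> a2; apply/eqP; rewrite -subr_eq0 -normr_le0.
apply: le0_of_le_geometric => k.
have s2 n : (2 <= shift 1 a n)%N by exact: a2.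
have h1 := cf_value_near k.+1 a2.
have /andP[? _] := cf_approx_bounds k s2.
have h2 := inv_tail_dist (a2 0%N) (_ : 0 <= cf_approx (shift 1 a) k)
  (cf_value_ge0 s2).
have {h2} := h2 (ltac:(done)); rewrite -cf_approxS => h2.
have h3 := cf_value_near k s2.
rewrite exprS in h1.
have p : 0 <= 4^-1 ^+ k :> R by rewrite exprn_ge0.
have := ler_distD (cf_approx a k.+1) (cf_value a)
   ((a 0)%:R + cf_value (shift 1 a))^-1.
rewrite (distrC (cf_value a) (cf_approx a k.+1)) => h4.
by apply: (le_trans h4); lra.
Qed.

Lemma cf_value_bounds a : (forall n, 2 <= a n)%N -> 0 <= cf_value a <= 2^-1.
Proof.
move=> a2; rewrite cf_valueE // inv_tail_bounds // cf_value_ge0 // => n.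
exact: a2.
Qed.

Lemma cf_value_tail a n : (forall n, 2 <= a n)%N ->
  cf_value a = cf_tail (history a n) (cf_value (shift n a)).
Proof.
move=> a2; elim: n => [//|n ->]; rewrite historyS /= shiftS cf_valueE //.
  by rewrite shift0n.
by move=> k; exact: a2.
Qed.

Lemma complete_quotient_cf_value a n : (forall n, 2 <= a n)%N ->
  complete_quotient (cf_value a) n.+1 = (a n)%:R + cf_value (shift n.+1 a).
Proof.
move=> a2; have s2 m k : (2 <= shift m a k)%N by exact: a2.
elim: n => [|n IH].
  have /andP[h0 h1] := cf_value_bounds a2.
  rewrite /complete_quotient /= (@floor_def _ _ 0).
    by rewrite subr0 [in LHS]cf_valueE // invrK.
  by rewrite h0 /= add0r; lra.
have -> : complete_quotient (cf_value a) n.+2 =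
   (complete_quotient (cf_value a) n.+1 -
    (Num.floor (complete_quotient (cf_value a) n.+1))%:~R)^-1 by [].
have /andP[h0 h1] := cf_value_bounds (s2 n.+1).
rewrite IH (@floor_def _ _ (a n)%:Z); last first.
  by rewrite rmorphD /= -pmulrn; apply/andP; split; lra.
rewrite -pmulrn addrC addrA addNr add0r [in LHS]cf_valueE // invrK -shiftS.
by rewrite shift0n.
Qed.

Lemma partial_quotient_cf_value a n : (forall n, 2 <= a n)%N ->
  partial_quotient (cf_value a) n.+1 = (a n)%:Z.
Proof.
move=> a2; rewrite /partial_quotient complete_quotient_cf_value //.
have /andP[h0 h1] := cf_value_bounds (fun k => a2 (n.+1 + k)%N).
by apply: floor_def; rewrite rmorphD /= -pmulrn; apply/andP; split; lra.
Qed.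

Lemma q_cf_value a n : (forall n, 2 <= a n)%N ->
  q_ n (cf_value a) = (den (history a n))%:Z.
Proof.
move=> a2; apply: denq_finite_cf => k; first exact: partial_quotient_cf_value.
by rewrite (leq_trans _ (a2 k)).
Qed.

End Value.

(** For a fraction [p / q], compare with the first convergent whose denominator
    [D] exceeds [q]: the two fractions differ by at least [1 / (q D)], the
    convergent is within [1 / (2 D^2)] of the number, and [D <= B q] because
    bounded digits bound the ratio of consecutive denominators. *)
Lemma Bad_cf_value (R : realType) (a : nat -> nat) (B : nat) :
  (forall n, 2 <= a n)%N -> (forall n, a n < B)%N -> Bad (cf_value R a).
Proof.
move=> a2 aB.
have a1 n : (0 < a n)%N by rewrite (leq_trans _ (a2 n)).
have all1 n : all (leq 1) (history a n) by exact: history_all.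
have B0 : (0 < B)%N by rewrite (leq_ltn_trans _ (aB 0%N)).
have B0R : 0 < B%:R :> R by rewrite ltr0n.
exists ((4 * B%:R)^-1); first by rewrite invr_gt0 mulr_gt0.
move=> q q1.
have /ex_minnP[n nq nmin] : exists n, (q < den (history a n))%N by exists q; exact: lt_den_history.
case: n => [|m] in nq nmin *; first by move: nq; rewrite ltnS leqNgt q1.
have mq : (den (history a m) <= q)%N.
  by rewrite leqNgt; apply/negP => /nmin; rewrite ltnn.
set h := history a m.+1 in nq nmin *.
have h1 : all (leq 1) h by exact: all1.
have dB : (den h <= B * q)%N.
  apply: (@leq_trans (B * den (history a m))); last by rewrite leq_mul2l mq orbT.
  rewrite /h historyS denS (leq_trans (leq_add (leqnn _) (den'_le (all1 m)))) //.
  by rewrite addnC -mulSn leq_mul2r aB orbT.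
have dh : (0 < den h)%N by exact: den_gt0.
have dhR : 0 < (den h)%:R :> R by rewrite ltr0n.
have qR : 0 < q%:R :> R by rewrite ltr0n.
apply: (@lt_le_trans _ _ ((2 * (den h)%:R)^-1)).
  rewrite -invfM ltf_pV2 ?posrE ?mulr_gt0 //.
  have : (den h)%:R <= B%:R * q%:R :> R by rewrite -natrM ler_nat.
  have : 0 < B%:R * q%:R :> R by rewrite mulr_gt0.
  lra.
apply: le_dist_int => p.
(* [p / q] is not the convergent with denominator [den h], because that
   fraction is reduced and [q < den h]. *)
have nz : (num h)%:Z * q%:Z - p * (den h)%:Z != 0.
  apply/eqP => e0; have := continuant_det int h.
  rewrite !natz; move: (size h).+1 => k hk.
  have : q%:Z * (-1) ^+ k = (den h)%:Z * (p * (den' h)%:Z - q%:Z * (num' h)%:Z).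
    by rewrite -hk -[LHS]subr0 -(mul0r (den' h)%:Z) -e0; ring.
  move=> /(congr1 absz); rewrite !abszM abszX /= exp1n muln1 => e1.
  have : (den h %| q)%N by rewrite e1 dvdn_mulr.
  by move=> /(dvdn_leq q1); rewrite leqNgt nq.
have nzR : 1 <= `|(num h)%:R * q%:R - p%:~R * (den h)%:R| :> R.
  have : 1 <= `|(num h)%:Z * q%:Z - p * (den h)%:Z| by lia.
  by rewrite -(ler_int R) intr_norm rmorphB !rmorphM /= -!pmulrn.
have /andP[v0 v1] := cf_value_bounds R (fun k => a2 (m.+1 + k)%N).
have := cf_tail_dist h1 v0 (lexx 0); rewrite -cf_value_tail //.
set v := cf_value _ _ in v0 v1 *; rewrite cf_tailE // !mulr0 !addr0 subr0.
rewrite (ger0_norm v0) => near.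
set d := (den h)%:R in dhR nzR near *; set y := cf_value _ _ in near *.
set z := (num h)%:R / d in near *.
have nearle : q%:R * `|y - z| <= (2 * d)^-1.
  have qd : q%:R <= d by rewrite ler_nat ltnW.
  have hd : 0 < d + (den' h)%:R * v by rewrite ltr_wpDr ?mulr_ge0.
  rewrite near mulrA ler_pdivrMr ?mulr_gt0 //.
  have -> : (2 * d)^-1 * ((d + (den' h)%:R * v) * d) = (d + (den' h)%:R * v) / 2.
    by field; rewrite gt_eqF.
  have : 0 <= (den' h)%:R * v by rewrite mulr_ge0.
  nra.
have far : d^-1 <= `|q%:R * z - p%:~R|.
  have -> : q%:R * z - p%:~R = ((num h)%:R * q%:R - p%:~R * d) / d.
    by rewrite /z; field; rewrite gt_eqF.
  by rewrite normrM normfV (gtr0_norm dhR) ler_peMl // invr_ge0 ltW.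
have := ler_distD (q%:R * y) (q%:R * z) p%:~R.
rewrite -mulrBr normrM (gtr0_norm qR) (distrC z y) => tri.
have : (2 * d)^-1 = d^-1 - (2 * d)^-1 by field; rewrite gt_eqF.
lra.
Qed.

(** * Separation of numbers with different digits *)

Lemma inv_tail_separated (R : realType) (B a b : nat) (t u : R) :
  (0 < a < B)%N -> (0 < b < B)%N -> a != b ->
  0 <= t <= 2^-1 -> 0 <= u <= 2^-1 ->
  (2 * B%:R ^+ 2)^-1 <= `|(a%:R + t)^-1 - (b%:R + u)^-1|.
Proof.
wlog ab : a b t u / (a < b)%N.
  move=> H a0 b0; rewrite neq_ltn => /orP[ab|ab] t0 u0.
    by apply: H => //; rewrite neq_ltn ab.
  by rewrite distrC; apply: H => //; rewrite neq_ltn ab.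
move=> /andP[a0 aB] /andP[b0 bB] _ /andP[t0 t1] /andP[u0 u1].
have abR : a%:R + 1 <= b%:R :> R by rewrite natr1 ler_nat.
have bBR : b%:R + 1 <= B%:R :> R by rewrite natr1 ler_nat.
have a0R : 1 <= a%:R :> R by rewrite ler1n.
have p1 : 0 < a%:R + t by lra.
have p2 : 0 < b%:R + u by lra.
have p3 : 0 < B%:R :> R by lra.
have -> : (a%:R + t)^-1 - (b%:R + u)^-1 =
   (b%:R + u - a%:R - t) / ((a%:R + t) * (b%:R + u)).
  by field; rewrite !gt_eqF.
rewrite ger0_norm; last by rewrite divr_ge0 ?mulr_ge0 //; lra.
rewrite ler_pdivlMr ?mulr_gt0 // mulrC ler_pdivrMr ?mulr_gt0 ?exprn_gt0 //.
have h1 : (a%:R + t) * (b%:R + u) <= B%:R ^+ 2.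
  by rewrite expr2 ler_pM ?ltW //; lra.
have h2 : 2^-1 <= b%:R + u - a%:R - t by lra.
have h3 : 0 < B%:R ^+ 2 :> R by rewrite exprn_gt0.
by nra.
Qed.

(** Each digit contracts differences by a factor at least [B^-2], and the first
    differing digit moves the value by at least half of that factor. *)
Lemma cf_value_separated (R : realType) (B : nat) (a b : nat -> nat) n :
  (forall k, 2 <= a k < B)%N -> (forall k, 2 <= b k < B)%N ->
  history a n != history b n ->
  2^-1 * (B%:R ^+ 2)^-1 ^+ n <= `|cf_value R a - cf_value R b|.
Proof.
elim: n a b => [//|n IH] a b aB bB.
have a2 k : (2 <= a k)%N by case/andP: (aB k).
have b2 k : (2 <= b k)%N by case/andP: (bB k).
have /andP[va0 va1] := cf_value_bounds R (fun k => a2 (1 + k)%N).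
have /andP[vb0 vb1] := cf_value_bounds R (fun k => b2 (1 + k)%N).
rewrite -!/(shift 1 _) in va0 va1 vb0 vb1.
have B0 : 2 <= B%:R :> R.
  by rewrite ler_nat; case/andP: (aB 0%N) => h /ltnW; apply: leq_trans.
have w0 : 0 <= (B%:R ^+ 2)^-1 :> R by rewrite invr_ge0 sqr_ge0.
have w1 : (B%:R ^+ 2)^-1 <= 1 :> R by rewrite invf_le1 ?exprn_gt0 //; nra.
rewrite !historySl eqseq_rcons negb_and (cf_valueE R a2) (cf_valueE R b2).
have [ab0 /= |ab0 _] := eqVneq (a 0%N) (b 0%N); last first.
  apply: (@le_trans _ _ (2 * B%:R ^+ 2)^-1).
    rewrite [leRHS]invfM ler_pM2l ?invr_gt0 // exprSr.
    by rewrite ler_piMl ?exprn_ile1.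
  apply: inv_tail_separated => //; rewrite ?va0 ?vb0 //.
  - by case/andP: (aB 0%N) => h ->; rewrite (leq_trans _ h).
  - by case/andP: (bB 0%N) => h ->; rewrite (leq_trans _ h).
rewrite orbF => neq; have := IH (shift 1 a) (shift 1 b) (fun k => aB _)
  (fun k => bB _) neq.
rewrite -ab0; set u := cf_value _ _ in va0 va1 *.
set v := cf_value _ _ in vb0 vb1 *.
have aBR : (a 0%N)%:R + 1 <= B%:R :> R.
  by rewrite natr1 ler_nat; case/andP: (aB 0%N).
have a2R : 2 <= (a 0%N)%:R :> R by rewrite ler_nat.
have pu : 0 < (a 0%N)%:R + u by lra.
have pv : 0 < (a 0%N)%:R + v by lra.
have -> : ((a 0%N)%:R + u)^-1 - ((a 0%N)%:R + v)^-1 =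
   (v - u) / (((a 0%N)%:R + u) * ((a 0%N)%:R + v)).
  by field; rewrite !gt_eqF.
rewrite normrM normfV (gtr0_norm (mulr_gt0 pu pv)) distrC => uv.
rewrite exprSr mulrA ler_pM ?mulr_ge0 ?exprn_ge0 ?invr_ge0 ?exprn_ge0 //;
  try by lra.
have B2 : 0 < B%:R ^+ 2 :> R by rewrite exprn_gt0 //; lra.
rewrite lef_pV2 ?posrE ?(mulr_gt0 pu pv) //.
by rewrite expr2 ler_pM ?ltW //; lra.
Qed.

(** * Admissible digits *)

Lemma count_blocks3 (P : pred nat) m L :
  (forall n, [|| P n, P n.+1 | P n.+2]) -> (L <= count P (iota m (3 * L)))%N.
Proof.
move=> h; elim: L m => // L IH m.
rewrite mulnS iotaD count_cat -add1n leq_add //= ?IH //.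
by have := h m; case: (P m); case: (P m.+1); case: (P m.+2).
Qed.

Lemma count_le1 (T : eqType) (P : pred T) (s : seq T) : uniq s ->
  (forall a b, a \in s -> b \in s -> P a -> P b -> a = b) -> (count P s <= 1)%N.
Proof.
move=> us h; rewrite -size_filter; case E : (seq.filter P s) => [//|a r].
have ain b : b \in a :: r -> b = a.
  have : a \in seq.filter P s by rewrite E mem_head.
  rewrite -E !mem_filter => /andP[Pa sa] /andP[Pb sb]; exact: h.
apply: (@uniq_leq_size _ (a :: r) [:: a]); first by rewrite -E filter_uniq.
by move=> b /ain ->; rewrite mem_head.
Qed.

Lemma count_has_le (I T : eqType) (P : I -> pred T) (r : seq I) (s : seq T) :
  (forall k, (count (P k) s <= 1)%N) ->
  (count (fun a => has (P^~ a) r) s <= size r)%N.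
Proof.
move=> h; elim: r => [|k r IH] /=; first by rewrite count_pred0.
apply: (@leq_trans (count (P k) s + count (fun a => has (P^~ a) r) s)).
  by rewrite -count_predUI leq_addr.
by rewrite -add1n leq_add.
Qed.

Section Lacunary.
Variable Q : nat -> nat.
Hypothesis Qle : forall k, (Q k <= Q k.+1)%N.
Hypothesis Q2 : forall k, (2 * Q k <= Q k.+2)%N.

Lemma lacunary_growth k n : (2 ^ n * Q k <= Q (k + 2 * n))%N.
Proof.
elim: n => [|n IH]; first by rewrite mul1n muln0 addn0.
rewrite mulnS addnA addnAC addn2 (leq_trans _ (Q2 _)) //.
by rewrite expnS -mulnA leq_mul2l IH.
Qed.

(** [Q] grows by a factor at least [2^n] over [2 n] steps, so that it leaves a
    window of ratio [2^n] within that many indices. *)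
Lemma lacunary_window u v n : (v <= 2 ^ n * u)%N ->
  exists k0, forall k, (u <= Q k < v)%N -> (k0 <= k < k0 + 2 * n)%N.
Proof.
move=> vu; have [/ex_minnP[k0 uk0 kmin]|none] := pselect (exists k, (u <= Q k)%N).
  exists k0 => k /andP[uk kv]; rewrite kmin //= ltnNge; apply/negP => kk.
  have QQ : (Q (k0 + 2 * n) <= Q k)%N by exact: (homo_leq leqnn leq_trans Qle).
  move: kv; rewrite ltnNge => /negP; apply.
  apply: leq_trans vu (leq_trans _ (leq_trans (lacunary_growth k0 n) QQ)).
  by rewrite leq_mul2l uk0 orbT.
by exists 0%N => k /andP[uk _]; case: none; exists k.
Qed.

End Lacunary.

Definition legal (B : nat) (h : seq nat) := all (fun a => (2 <= a < B)%N) h.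

Lemma legal_pos B h : legal B h -> all (leq 1) h.
Proof. by apply: sub_all => a /andP[/ltnW]. Qed.

Lemma legal_den B h : legal B h -> h != [::] -> (den h <= B * den' h)%N.
Proof.
case: h => // a h /= /andP[/andP[_ aB] lh] _; rewrite denS den'S.
apply: (@leq_trans (a.+1 * den h)); last by rewrite leq_mul2r aB orbT.
by rewrite mulSn addnC leq_add2r den'_le // (legal_pos lh).
Qed.

Section Admissible.
Variables (R : realType) (x e : R) (Q : nat -> nat).

(** After the digits [h], the multiplier [Q k] has to be dealt with when its
    size lies between the squares of the last two denominators: then the
    possible values of the next tail spread [Q k * y] over at most half a unit,
    while the cylinders of two different next digits are still separated
    by a definite proportion of [1 / Q k]. *)
Definition hits (h : seq nat) (k a : nat) : bool :=
  (den' h ^ 2 <= Q k < den h ^ 2)%N &&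
  `[< exists2 t : R, 0 <= t <= 2^-1 &
      dist_int ((Q k)%:R * cf_tail (a :: h) t) < e >].

Definition admissible (h : seq nat) (a : nat) : bool :=
  (e <= dist_int ((den (a :: h))%:R * x)) && ~~ `[< exists k, hits h k a >].

Lemma admissible_next h : 4 * e <= 1 -> e <= dist_int ((den h)%:R * x) ->
  forall a, [|| e <= dist_int ((den (a :: h))%:R * x),
     e <= dist_int ((den (a.+1 :: h))%:R * x) |
     e <= dist_int ((den (a.+2 :: h))%:R * x)].
Proof.
move=> e4 eh a; have := dist_int_progression ((den (a :: h))%:R * x) e4 eh.
have -> : (den (a :: h))%:R * x + (den h)%:R * x = (den (a.+1 :: h))%:R * x.
  by rewrite !denS -[a.+1]addn1 !natrD !natrM natrD; ring.
have -> : (den (a :: h))%:R * x + 2 * ((den h)%:R * x) = (den (a.+2 :: h))%:R * x.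
  by rewrite !denS -[a.+2]addn2 !natrD !natrM natrD; ring.
by case=> ->; rewrite ?orbT.
Qed.

(** Two digits hit by the same [Q k] would give two points with
    [Q k * y] within [e] of the same integer, hence closer than [2 e / Q k],
    against the separation of their cylinders. *)
Lemma hits_unique (B : nat) h k a b :
  16 * B%:R ^+ 4 * e <= 1 -> (forall k, 0 < Q k)%N -> legal B h ->
  (2 <= a < B)%N -> (2 <= b < B)%N -> hits h k a -> hits h k b -> a = b.
Proof.
move=> eB Q0 lh aB bB /andP[/andP[q'Q Qq] /asboolP[t t01 ha]].
move=> /andP[_ /asboolP[u u01 hb]]; apply/eqP; apply/negPn/negP => ab.
have h1 := legal_pos lh.
have hn : h != [::].
  by apply: contraTneq Qq => ->; rewrite /den /= exp1n ltnS -ltnNge.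
have dd' : (den h)%:R <= B%:R * (den' h)%:R :> R.
  by rewrite -natrM ler_nat legal_den.
have d'd : (den' h)%:R <= (den h)%:R :> R by rewrite ler_nat den'_le.
have d0 : 0 < (den h)%:R :> R by rewrite ltr0n den_gt0.
have KqR : (Q k)%:R <= (den h)%:R ^+ 2 :> R by rewrite -natrX ler_nat ltnW.
have qKR : (den' h)%:R ^+ 2 <= (Q k)%:R :> R by rewrite -natrX ler_nat.
have K0 : 0 < (Q k)%:R :> R by rewrite ltr0n.
have d'0 : 0 <= (den' h)%:R :> R by [].
have B2 : 2 <= B%:R :> R.
  by rewrite ler_nat; case/andP: aB => h2 /ltnW; apply: leq_trans.
have aP : (0 < a < B)%N by case/andP: aB => h2 ->; rewrite (leq_trans _ h2).
have bP : (0 < b < B)%N by case/andP: bB => h2 ->; rewrite (leq_trans _ h2).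
have sep := inv_tail_separated aP bP ab t01 u01.
case/andP: aB => a2 _; case/andP: bB => b2 _.
case/andP: t01 => t0 t1; case/andP: u01 => u0 u1.
have /andP[ta0 ta1] := inv_tail_bounds a2 t0.
have /andP[ub0 ub1] := inv_tail_bounds b2 u0.
have := cf_tail_dist h1 ta0 ub0.
move: ha hb; rewrite [cf_tail (a :: h) t]/= [cf_tail (b :: h) u]/=.
rewrite -!/(cf_tail h _).
set t' := (a%:R + t)^-1 in ta0 ta1 sep *.
set u' := (b%:R + u)^-1 in ub0 ub1 sep *.
set y := cf_tail h t'; set z := cf_tail h u'.
set K := (Q k)%:R in KqR qKR K0 *.
set d := (den h)%:R in dd' d'd d0 KqR *.
set d' := (den' h)%:R in dd' d'd d'0 qKR *.
move=> /dist_int_lt[m hm] /dist_int_lt[n hn'] yz.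
have w0 : 0 <= d' * t' by rewrite mulr_ge0.
have w1 : d' * t' <= d by nra.
have v0 : 0 <= d' * u' by rewrite mulr_ge0.
have v1 : d' * u' <= d by nra.
set W := (d + d' * t') * (d + d' * u') in yz.
have Wlo : d ^+ 2 <= W by rewrite /W; nra.
have Whi : W <= 4 * d ^+ 2 by rewrite /W; nra.
have W0 : 0 < W by rewrite (lt_le_trans _ Wlo) // exprn_gt0.
have near : K * `|y - z| <= 2^-1.
  rewrite yz mulrA ler_pdivrMr //.
  have tu : `|t' - u'| <= 2^-1 by rewrite ler_norml; apply/andP; split; lra.
  have : 0 <= `|t' - u'| by []; nra.
have kyz : `|K * y - K * z| = K * `|y - z|.
  by rewrite -mulrBr normrM (gtr0_norm K0).
have B4 : 16 <= B%:R ^+ 4 :> R.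
  rewrite (_ : 16 = 2 ^+ 4); last by rewrite -natrX.
  by rewrite lerXn2r ?nnegrE //; lra.
have e_small : 256 * e <= 1.
  have [?|?] := leP 0 e; first nra.
  lra.
have mn : m = n.
  apply: (@int_eq_dist_lt1 R); rewrite -kyz in near.
  move: near hm hn'; rewrite !ltr_norml ler_norml.
  by move=> /andP[? ?] /andP[? ?] /andP[? ?]; apply/andP; split; lra.
rewrite -mn in hn'.
have close : K * `|y - z| < 2 * e.
  rewrite -kyz; move: hm hn'; rewrite !ltr_norml.
  by move=> /andP[? ?] /andP[? ?]; apply/andP; split; lra.
have BB : 0 < 8 * B%:R ^+ 4 :> R by rewrite mulr_gt0 // exprn_gt0 //; lra.
have far : (8 * B%:R ^+ 4)^-1 <= K * `|y - z|.
  rewrite yz [leRHS]mulrA ler_pdivlMr //.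
  apply: (@le_trans _ _ ((8 * B%:R ^+ 4)^-1 * (4 * (B%:R * d') ^+ 2))).
    rewrite ler_pM2l ?invr_gt0 // (le_trans Whi) // ler_pM2l //.
    by rewrite lerXn2r ?nnegrE ?mulr_ge0 // ltW.
  have -> : (8 * B%:R ^+ 4)^-1 * (4 * (B%:R * d') ^+ 2) =
     d' ^+ 2 * (2 * B%:R ^+ 2)^-1 :> R.
    by field; rewrite gt_eqF //; lra.
  by rewrite ler_pM ?sqr_ge0 ?invr_ge0 ?mulr_ge0 ?sqr_ge0.
have := le_lt_trans far close; rewrite ltNge => /negP[].
rewrite -[leRHS]div1r ler_pdivlMr //.
by apply: le_trans eB; rewrite le_eqVlt; apply/orP; left; apply/eqP; ring.
Qed.

End Admissible.

(** Of the [6 N] available digits a third survives the condition on [x], and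
    the digits hit by some [Q k] number at most [4 (i + 3)]: one for each of the
    indices in a window of ratio [(2^(i+3))^2]. *)
Lemma count_admissible (R : realType) (x e : R) (Q : nat -> nat) i h :
  (6 <= i)%N -> 16 * (2 ^ (i + 3))%:R ^+ 4 * e <= 1 ->
  (forall k, 0 < Q k)%N -> (forall k, Q k <= Q k.+1)%N ->
  (forall k, 2 * Q k <= Q k.+2)%N ->
  legal (2 ^ (i + 3)) h -> e <= dist_int ((den h)%:R * x) ->
  (2 ^ i <= count (admissible x e Q h) (iota 2 (6 * 2 ^ i)))%N.
Proof.
move=> i6 eB Q0 Qle Q2 lh eh; set N := (2 ^ i)%N; set B := (2 ^ (i + 3))%N.
have N64 : (64 <= N)%N by rewrite -[64%N]/(2 ^ 6)%N leq_exp2l.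
have BE : B = (8 * N)%N by rewrite /B expnD mulnC.
have iN : (4 * (i + 3) <= N)%N.
  rewrite /N -(subnK i6); elim: (i - 6)%N => // n IH.
  by rewrite addSn expnS; lia.
have e4 : 4 * e <= 1.
  have B1 : 1 <= B%:R ^+ 4 :> R by rewrite exprn_ege1 // ler1n; lia.
  by have [?|?] := leP 0 e; [nra|lra].
have good1 := count_blocks3 2 (2 * N) (admissible_next e4 eh).
rewrite mulnA -[(3 * 2)%N]/6%N in good1.
set s := iota 2 (6 * N) in good1 *.
have sB a : a \in s -> (2 <= a < B)%N.
  by rewrite mem_iota BE => /andP[-> h2] /=; lia.
have [k0 hk0] : exists k0, forall k a, hits e Q h k a ->
    (k0 <= k < k0 + 2 * (2 * (i + 3)))%N.
  have [hn|hn] := eqVneq h [::].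
    exists 0%N => k a; rewrite hn => /andP[/andP[_]].
    by rewrite /den /= exp1n ltnS leqNgt Q0.
  have [|k0 hk] := @lacunary_window Q Qle Q2 (den' h ^ 2) (den h ^ 2)
      (2 * (i + 3)).
    by rewrite (mulnC 2) expnM -expnMn leq_sqr legal_den.
  by exists k0 => k a /andP[/hk].
set r := iota k0 (2 * (2 * (i + 3))).
have few : (count (fun a => has ((hits e Q h)^~ a) r) s <= 4 * (i + 3))%N.
  rewrite (_ : 4 * (i + 3) = size r)%N; last by rewrite size_iota mulnA.
  apply: count_has_le => k; apply: count_le1; first exact: iota_uniq.
  move=> a b /sB aB /sB bB; exact: (hits_unique eB Q0 lh).
have : (count (fun a => (e <= dist_int ((den (a :: h))%:R * x))%R) s <=
   count (admissible x e Q h) s +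
   count (fun a => has ((hits e Q h)^~ a) r) s)%N.
  rewrite -count_predUI (leq_trans _ (leq_addr _ _)) //.
  apply: sub_count => a /= ea; rewrite /admissible ea /=.
  case: asboolP => //= -[k hk]; apply/hasP; exists k => //.
  by rewrite mem_iota (hk0 _ _ hk).
move: good1 few iN; set c1 := count _ _; set c2 := count _ _; set c3 := count _ _.
move: c1 c2 c3 => c1 c2 c3; lia.
Qed.

(** * Points of the fibre *)

(** Every [q_n(x)] lies between the squares of two consecutive denominators of
    the constructed number, so the choice of one of its digits has dealt with
    it. *)
Lemma fibre_mem (R : realType) (x c e : R) (B : nat) (a : nat -> nat) :
  0 < e -> 0 < c -> (forall q, (1 <= q)%N -> c / q%:R < dist_int (q%:R * x)) ->
  (forall k, 2 <= a k < B)%N ->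
  (forall n, admissible x e (fun k => den (history (digit x) k)) (history a n) (a n)) ->
  (@set_A R `&` @vertical_line R x) (x, cf_value R a).
Proof.
move=> e0 c0 hc aB adm.
have xBad : Bad x by exists c.
have xr := Bad_irrational xBad.
have a2 k : (2 <= a k)%N by case/andP: (aB k).
have aB' k : (a k < B)%N by case/andP: (aB k).
have a1 k : (0 < a k)%N by rewrite (leq_trans _ (a2 k)).
have yBad := Bad_cf_value R a2 aB'.
split; last by split.
split => //=; have [cy cy0 hcy] := yBad.
set y := cf_value R a.
have good_xy n : e <= dist_int ((den (history (digit x) n))%:R * y).
  set Qn := den (history (digit x) n).
  have Qn0 : (0 < Qn)%N by apply: den_history_gt0 => k; exact: digit_gt0.
  have grow m : (m < den (history a m))%N by exact: lt_den_history.
  have /ex_minnP[m hm mmin] : exists m, (Qn < den (history a m) ^ 2)%N.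
    exists Qn; apply: (leq_trans (grow Qn)).
    by rewrite -[leqLHS]muln1 -mulnn leq_mul2l (leq_ltn_trans _ (grow Qn)) ?orbT.
  case: m => [|m] in hm mmin; first by move: hm; rewrite /den /= exp1n ltnS leqNgt Qn0.
  have /andP[_ /asboolPn nohit] := adm m.+1.
  rewrite leNgt; apply/negP => lt; apply: nohit; exists n; apply/andP; split.
    rewrite hm andbT historyS den'S leqNgt; apply/negP => /mmin.
    by rewrite ltnn.
  apply/asboolP; exists (cf_value R (shift m.+2 a)).
    by apply: cf_value_bounds => k; exact: a2.
  by rewrite -historyS -cf_value_tail.
have good_yx n : e <= dist_int ((den (history a n.+1))%:R * x).
  by have /andP[h _] := adm n; rewrite historyS.
have large (z d : R) (q : nat) : (1 <= q)%N -> d / q%:R < dist_int (q%:R * z) ->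
    d <= q%:R * dist_int (q%:R * z).
  move=> q1 /ltW; rewrite ler_pdivrMr ?ltr0n // mulrC //.
exists (Num.min c cy * e); first by rewrite mulr_gt0 // lt_min c0.
have m0 : 0 <= Num.min c cy by rewrite le_min !ltW.
case=> // n _; rewrite q_E // q_cf_value // -!pmulrn; split.
- have Q0 : (0 < den (history (digit x) n.+1))%N.
    by apply: den_history_gt0 => k; exact: digit_gt0.
  rewrite ler_pM ?(ltW e0) //.
  by rewrite (le_trans _ (large _ _ _ Q0 (hc _ Q0))) // ge_min lexx.
- have Q0 : (0 < den (history a n.+1))%N by exact: den_history_gt0.
  rewrite mulrAC ler_pM ?(ltW e0) //.
  by rewrite (le_trans _ (large _ _ _ Q0 (hcy _ Q0))) // ge_min lexx orbT.
Qed.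

(** * Branches avoiding a small family of cylinders *)

Lemma suffix_cons_inj (T : eqType) (a b : T) h w :
  suffix (a :: h) w -> suffix (b :: h) w -> a = b.
Proof. by rewrite !suffixE /= => /eqP -> /eqP[]. Qed.

Lemma suffix_behead (T : eqType) (a : T) h w : suffix (a :: h) w -> suffix h w.
Proof. by move=> /suffixP[s ->]; rewrite -cat_rcons suffix_suffix. Qed.

Section Tree.
Variables (R : realType) (N : nat) (w : nat -> seq nat).
Variables (legit : seq nat -> Prop) (children : seq nat -> seq nat).
Hypothesis N0 : (0 < N)%N.
Hypothesis legit0 : legit [::].
Hypothesis legitS : forall h a, legit h -> a \in children h -> legit (a :: h).
Hypothesis children_uniq : forall h, uniq (children h).
Hypothesis children_size : forall h, legit h -> (N <= size (children h))%N.

Let c (n : nat) : R := (N%:R)^-1 ^+ n.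

Let c_ge0 n : 0 <= c n.
Proof. by rewrite exprn_ge0 ?invr_ge0. Qed.

Let weight (h : seq nat) : \bar R :=
  (\sum_(0 <= i <oo) (if suffix h (w i) then c (size (w i)) else 0)%:E)%E.

Let term_ge0 h i : (0 <= (if suffix h (w i) then c (size (w i)) else 0)%:E)%E.
Proof. by rewrite lee_fin; case: ifP. Qed.

Let weight_children h : (\sum_(a <- children h) weight (a :: h) <= weight h)%E.
Proof.
rewrite /weight -nneseries_sum; last by move=> *; exact: term_ge0.
apply: lee_nneseries => i _; first by move=> _; apply: sume_ge0.
rewrite sumEFin lee_fin -big_mkcond /= big_const_seq.
have h1 : (count (fun a => suffix (a :: h) (w i)) (children h) <= 1)%N.
  apply: count_le1 => // a b _ _; exact: suffix_cons_inj.
case: ifPn => [_|hn].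
  by case: (count _ _) h1 => [|[]] //= _; rewrite ?addr0.
rewrite (_ : count _ _ = 0%N) //; apply/eqP; rewrite -leqn0 leqNgt -has_count.
by apply/hasPn => a _; apply: contra hn; exact: suffix_behead.
Qed.

Let light_child h : legit h -> (weight h < (c (size h))%:E)%E ->
  exists a, a \in children h /\ (weight (a :: h) < (c (size (a :: h)))%:E)%E.
Proof.
move=> lh wh; apply: contrapT => /forallNP none.
move: wh; rewrite ltNge => /negP[]; apply: le_trans (weight_children h).
apply: (@le_trans _ _ (\sum_(a <- children h) (c (size h).+1)%:E)%E).
  rewrite sumEFin lee_fin big_const_seq count_predT iter_addr_0.
  rewrite /c exprS -mulrnAl -[leLHS]mul1r ler_wpM2r ?c_ge0 //.
  rewrite -[_ *+ _]mulr_natr mulrC ler_pdivlMr ?ltr0n // mul1r ler_nat.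
  exact: children_size.
rewrite big_seq [leRHS]big_seq; apply: lee_sum => a ah.
by rewrite leNgt; apply/negP => lt; exact: (none a).
Qed.

(** Give a word of length [n] the weight [N^-n], and a node the total weight of
    the words below it. A node of length [n] of weight less than [N^-n] has at
    least [N] children whose weights add up to at most its own, so some child
    of length [n + 1] has weight less than [N^-(n+1)]. A branch descending
    through such nodes meets no word, since a word alone outweighs the bound
    for its own node. *)
Lemma branch_avoiding_words :
  (\sum_(0 <= i <oo) (N%:R^-1 ^+ size (w i))%:E < 1%:E :> \bar R)%E ->
  exists a : nat -> nat, [/\ forall n, legit (history a n),
    forall n, a n \in children (history a n) &
    forall i n, history a n != w i].
Proof.
move=> small; pose light h := legit h /\ (weight h < (c (size h))%:E)%E.
have light0 : light [::].
  split=> //; rewrite /c expr0 /weight.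
  by under eq_eseriesr do rewrite suffix0s.
have /choice[g hg] : forall h, exists a, light h -> a \in children h /\ light (a :: h).
  move=> h; have [[lh wh]|nl] := pselect (light h); last by exists 0%N.
  have [a [ah wa]] := light_child lh wh; exists a => _; split=> //; split=> //.
  exact: legitS.
pose hist n := iter n (fun h => g h :: h) [::].
have lightn n : light (hist n) by elim: n => //= n /hg[].
pose a n := g (hist n).
have ha n : history a n = hist n by elim: n => //= n IH; rewrite historyS IH.
exists a; split=> [n|n|i n]; rewrite ha.
- by case: (lightn n).
- by case: (hg _ (lightn n)).
apply/eqP => hw; have [_] := lightn n; rewrite ltNge => /negP[].
rewrite hw /weight (@nneseriesD1 _ _ i) //.
rewrite suffix_refl; apply: leeDl; apply: nneseries_ge0 => k _ _.
exact: term_ge0.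
Qed.

End Tree.

(** * Covers *)

Lemma hausdorff_null_cover (R : realType) (T : choiceType) (d : T -> T -> R)
    (s delta eta : R) (E : set T) :
  hausdorff_measure d s E = 0%E -> 0 < delta -> 0 < eta ->
  exists U : nat -> set T, [/\ E `<=` \bigcup_i U i,
    forall i, (diam d (U i) <= delta%:E)%E &
    (\sum_(0 <= i <oo | U i != set0) diam d (U i) `^ s < eta%:E)%E].
Proof.
move=> H0 delta0 eta0.
have : (hausdorff_premeasure d s delta E < eta%:E)%E.
  apply: (@le_lt_trans _ _ 0%E); last by rewrite lte_fin.
  by rewrite -H0; apply: ereal_sup_ubound; exists delta.
by move=> /ereal_inf_lt[_ [U [EU Ud] <-] lt]; exists U.
Qed.

Lemma eucl_dist_vertical (R : realType) (x y z : R) :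
  eucl_dist (x, y) (x, z) = `|y - z|.
Proof. by rewrite /eucl_dist /= subrr expr0n add0r sqrtr_sqr. Qed.

Lemma cover_word (R : realType) (x : R) (B n : nat) (U : set (R * R)) :
  (diam (@eucl_dist R) U < (2^-1 * (B%:R ^+ 2)^-1 ^+ n)%:E)%E ->
  exists2 v : seq nat, size v = n &
    forall a, (forall k, 2 <= a k < B)%N -> U (x, cf_value R a) -> history a n = v.
Proof.
move=> dU.
have [[b bB Ub]|none] := pselect (exists2 b, (forall k, 2 <= b k < B)%N &
    U (x, cf_value R b)); last first.
  exists (nseq n 0%N); first exact: size_nseq.
  by move=> a aB Ua; case: none; exists a.
exists (history b n); first exact: size_history.
move=> a aB Ua; apply/eqP/negPn/negP => ab.
move: dU; rewrite ltNge => /negP[].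
apply: (@le_trans _ _ (eucl_dist (x, cf_value R a) (x, cf_value R b))%:E).
  by rewrite eucl_dist_vertical lee_fin cf_value_separated.
by apply: ereal_sup_ubound; exists ((x, cf_value R a), (x, cf_value R b)).
Qed.

(** The level [n] is the last one whose cylinders are still separated by more
    than the diameter. A set of diameter zero has no such level; a level that
    depends on [k] gives it a summable cost. *)
Lemma cover_level (R : realType) (s : R) (i k : nat) (D : \bar R) :
  0 <= s -> (0 < i)%N -> s * (2 * (i + 3)%:R) <= i%:R -> (D < 2^-1%:E)%E ->
  let B : R := (2 ^ (i + 3))%:R in
  exists n : nat, (D < (2^-1 * (B ^+ 2)^-1 ^+ n)%:E)%E /\
   (((2 ^ i)%:R^-1 ^+ n)%:E <=
     ((2 * B ^+ 2) `^ s)%:E * (if (0 < D)%E then D `^ s else 0)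
       + (2^-1 / (2 ^ k.+1)%:R)%:E)%E.
Proof.
move=> s0 i0 si D2 B.
have BE : B = 2 ^+ (i + 3) by rewrite /B natrX.
have B4 : 4 <= B ^+ 2.
  have h : 2 <= B.
    by rewrite /B ler_nat -{1}[2%N]expn1 leq_exp2l // addn_gt0 orbT.
  nra.
have B20 : 0 < B ^+ 2 by lra.
case: ltP => [D0|D0]; last first.
  exists k.+2; split.
    apply: le_lt_trans D0 _; rewrite lte_fin mulr_gt0 //.
    by rewrite exprn_gt0 // invr_gt0.
  rewrite mule0 add0e lee_fin -invfM exprVn lef_pV2 ?posrE; last 2 first.
  - by rewrite exprn_gt0 // ltr0n expn_gt0.
  - by rewrite mulr_gt0 // ltr0n expn_gt0.
  rewrite -natrM -expnS -natrX ler_nat -expnM leq_exp2l //.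
  by rewrite leq_pmull.
case: D D0 D2 => [d| |] //; rewrite !lte_fin => d0 d2.
set w := (B ^+ 2)^-1.
have w0 : 0 < w by rewrite invr_gt0.
have w4 : w <= 4^-1 by rewrite lef_pV2 // posrE; lra.
have /ex_minnP[n hn nmin] : exists n, 2^-1 * w ^+ n.+1 <= d.
  apply: contrapT => /forallNP none; move: d0; apply/negP; rewrite -leNgt.
  apply: le0_of_le_geometric => m; have := none m => /negP.
  rewrite -ltNge => /ltW /le_trans -> //.
  have wm : w ^+ m <= 4^-1 ^+ m by rewrite lerXn2r ?nnegrE ?invr_ge0 // ltW.
  have wm0 : 0 <= w ^+ m by rewrite exprn_ge0 // ltW.
  by rewrite exprS mulrA ler_pM // ?mulr_ge0 ?ltW //; lra.
exists n; rewrite lte_fin; split.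
  case: n nmin {hn} => [|n] nmin; first by rewrite expr0 mulr1.
  by rewrite ltNge; apply/negP => /nmin; rewrite ltnn.
rewrite poweR_EFin -EFinM -EFinD lee_fin.
apply: (@le_trans _ _ ((2 * B ^+ 2) `^ s * d `^ s)); last first.
  by rewrite lerDl divr_ge0.
have wn : w ^+ n <= 2 * B ^+ 2 * d.
  have -> : w ^+ n = 2 * B ^+ 2 * (2^-1 * w ^+ n.+1).
    have wB : w * B ^+ 2 = 1 by rewrite mulVf // gt_eqF.
    transitivity (w * B ^+ 2 * w ^+ n); first by rewrite wB mul1r.
    by rewrite [w ^+ n.+1]exprS; field.
  by rewrite ler_pM2l // mulr_gt0.
have C0 : 0 <= 2 * B ^+ 2 by rewrite mulr_ge0 // ltW.
rewrite -powRM //; last exact: ltW.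
apply: (@le_trans _ _ ((w ^+ n) `^ s)); last first.
  have wn0 : 0 <= w ^+ n by rewrite exprn_ge0 // ltW.
  by apply: ge0_ler_powR => //; rewrite nnegrE // (le_trans wn0).
have -> : w ^+ n = 2 `^ (- (2 * (i + 3) * n)%:R).
  by rewrite powRN powR_mulrn // /w exprVn BE -!exprM (mulnC 2).
have -> : (2 ^ i)%:R^-1 ^+ n = 2 `^ (- (i * n)%:R) :> R.
  by rewrite powRN powR_mulrn // exprVn natrX -exprM.
rewrite -powRrM ler_powR ?ler1n // mulNr lerN2 !natrM mulrC mulrA.
by rewrite ler_wpM2r.
Qed.

(** * Dimension of the fibre *)

(** The exponent 1/2 enters here: [2^i] children against the contraction
    [4^-(i+3)] of a single digit give the inequality
    [2^-i <= (4^-(i+3))^s] as soon as [s < 1/2] and [i] is large. *)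
Lemma exists_scale (R : realType) (s : R) : 0 <= s -> s < 2^-1 ->
  exists2 i : nat, (6 <= i)%N & s * (2 * (i + 3)%:R) <= i%:R.
Proof.
move=> s0 s2; have p : 0 < 1 - 2 * s by lra.
have := @archi_boundP R (6 * s / (1 - 2 * s)).
set k := Num.bound _; rewrite ler_pdivlMr // mul0r mulr_ge0 // => /(_ isT).
rewrite ltr_pdivrMr // => hk; exists (k + 6)%N; first by rewrite leq_addl.
rewrite !natrD; nra.
Qed.

(** A cover of the fibre with small sum would give a family of words, one for
    each covering set, of total weight less than one. *)
Lemma hausdorff_measure_fibre_neq0 (R : realType) (x s : R) :
  Bad x -> 0 <= s -> s < 2^-1 ->
  hausdorff_measure (@eucl_dist R) s (@set_A R `&` @vertical_line R x) <> 0%E.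
Proof.
move=> xBad s0 s2 H0; have [c c0 hc] := xBad.
have [i i6 si] := exists_scale s0 s2.
have i0 : (0 < i)%N by rewrite (leq_trans _ i6).
set B : R := (2 ^ (i + 3))%:R.
have B0 : 0 < B by rewrite ltr0n expn_gt0.
(* [e <= c] makes the empty word legitimate, since [||x|| > c]; the other bound
   is what the uniqueness of a hit digit requires. *)
pose e := Num.min c (16 * B ^+ 4)^-1.
have e0 : 0 < e by rewrite lt_min c0 invr_gt0 mulr_gt0 // exprn_gt0.
have eB : 16 * B ^+ 4 * e <= 1.
  have pB : 0 < 16 * B ^+ 4 by rewrite mulr_gt0 // exprn_gt0.
  by rewrite mulrC -ler_pdivlMr // div1r ge_min lexx orbT.
set C := (2 * B ^+ 2) `^ s.
have C0 : 0 < C by rewrite powR_gt0 // mulr_gt0 // exprn_gt0.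
have [U [EU Ud Usum]] := @hausdorff_null_cover _ _ _ s 4^-1 ((2 * C)^-1) _ H0
  ltac:(by []) ltac:(by rewrite invr_gt0 mulr_gt0).
set D := diam (@eucl_dist R) in Ud Usum.
have D2 k : (D (U k) < 2^-1%:E)%E.
  by apply: le_lt_trans (Ud k) _; rewrite lte_fin; lra.
have /choice[n hn] := fun k => cover_level k s0 i0 si (D2 k).
have /choice[w hw] : forall k, exists v : seq nat, size v = n k /\
    forall a, (forall j, 2 <= a j < 2 ^ (i + 3))%N ->
      U k (x, cf_value R a) -> history a (n k) = v.
  by move=> k; have [/(cover_word x)[v vn vU] _] := hn k; exists v.
have small : (\sum_(0 <= k <oo) ((2 ^ i)%:R^-1 ^+ size (w k))%:E < 1%:E :> \bar R)%E.
  pose A k := (C%:E * (if 0 < D (U k) then D (U k) `^ s else 0))%E.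
  have A0 k : (0 <= A k)%E.
    rewrite mule_ge0 ?lee_fin ?(ltW C0) //; case: ifP => // _.
    exact: poweR_ge0.
  apply: (@le_lt_trans _ _
     (\sum_(0 <= k <oo) (A k + (2^-1 / (2 ^ k.+1)%:R)%:E))%E).
    apply: lee_nneseries => k _; first by rewrite lee_fin exprn_ge0 ?invr_ge0.
    by have [-> _] := hw k; have [_] := hn k.
  have h2 : 0 <= 2^-1 :> R by rewrite invr_ge0.
  apply: (le_lt_trans (epsilon_trick xpredT A0 h2)).
  have -> : 1%:E = (2^-1%:E + 2^-1%:E :> \bar R)%E by rewrite -EFinD; congr _%:E; lra.
  rewrite lteD2rE //; apply: (@le_lt_trans _ _
      (C%:E * \sum_(0 <= k <oo | U k != set0) D (U k) `^ s)%E).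
    rewrite -nneseriesZl; last by move=> k _; exact: poweR_ge0.
    rewrite [leRHS]eseries_mkcond; apply: lee_nneseries => k _.
      by move=> _; exact: A0.
    rewrite /A; case: ifP => [Dpos|_].
      case: ifPn => // /negPn/eqP Uk; move: Dpos.
      by rewrite Uk /D /diam setX0 image_set0 ereal_sup0.
    by rewrite mule0; case: ifP => // _; rewrite mule_ge0 ?lee_fin ?(ltW C0) ?poweR_ge0.
  apply: (@lt_le_trans _ _ (C%:E * ((2 * C)^-1)%:E)%E).
    by rewrite lte_pmul2l ?lte_fin.
  by rewrite -EFinM lee_fin invfM mulrCA divff ?mulr1 // gt_eqF.
set Q := fun k => den (history (digit x) k).
have xr := Bad_irrational xBad.
have d0 k : (0 < digit x k)%N by exact: digit_gt0.
(* The bound on [||q_n x||] is carried along because it is the step of the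
   progression in which the next digit is chosen. *)
pose legit h := legal (2 ^ (i + 3)) h /\ e <= dist_int ((den h)%:R * x).
pose children h := [seq a <- iota 2 (6 * 2 ^ i) | admissible x e Q h a].
have digit_range h a : a \in children h -> (2 <= a < 2 ^ (i + 3))%N.
  have : (0 < 2 ^ i)%N by rewrite expn_gt0.
  rewrite mem_filter mem_iota expnD => ? /andP[_ /andP[-> ?]] /=; lia.
have [||||||a [_ achild aw]] := @branch_avoiding_words R (2 ^ i) w legit children.
- by rewrite expn_gt0.
- split=> //; rewrite /den /= ltW // (le_lt_trans _ (hc 1%N _)) //.
  by rewrite divr1 ge_min lexx.
- move=> h a [lh eh] ah; split; first by rewrite /= (digit_range _ _ ah).
  by move: ah; rewrite mem_filter => /andP[/andP[]].
- by move=> h; rewrite filter_uniq // iota_uniq.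
- move=> h [lh eh]; rewrite size_filter; apply: count_admissible => // k.
  + exact: den_history_gt0.
  + exact: den_history_le.
  + exact: den_history_double.
- exact: small.
have aB k : (2 <= a k < 2 ^ (i + 3))%N by exact: digit_range (achild k).
have : (@set_A R `&` @vertical_line R x) (x, cf_value R a).
  apply: (fibre_mem e0 c0 hc aB) => k; have := achild k.
  by rewrite mem_filter => /andP[].
move=> /EU[k _ Uk]; have /eqP := aw k (n k); apply.
by have [_ ->] := hw k.
Qed.

Theorem proposition2 (R : realType) (x : R) (hx : @Bad R x) :
  ((2^-1 : R)%:E <=
    hausdorff_dim (@eucl_dist R) (@set_A R `&` @vertical_line R x))%E.
Proof.
apply: le_ereal_inf_tmp => _ [s [s0 H0] <-]; rewrite lee_fin leNgt.
by apply/negP => s2; exact: (hausdorff_measure_fibre_neq0 hx s0 s2).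
Qed.
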